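(* Let $K$ be a finite field, $\mathbf{F}$ the free group with finite basis $B$, $\mathcal{A}=K[\mathbf{F}]$ and $m\ge1$. Let $\mathbb{T}=T_1\cup\ldots\cup T_m$ be a collection of finite, possibly empty, subtrees $T_i\subset\mathcal{C}_i$, and assume that $M\le\mathcal{A}^m$ is a submodule having a generating set each of whose elements is supported on the vertices of $\mathbb{T}$. Then in every exposure of $M$ along $\mathbb{T}$ (according to any exploration order of $\mathbb{T}$), the number of coincidences is equal to $\mathrm{rk}\,M$. Moreover, $M$ admits a basis supported on $\mathbb{T}$. In fact, given an exploration order of $\mathbb{T}$, every set of elements $f_1,\ldots,f_{\mathrm{rk}M}\in M$ supported on $\mathbb{T}$, such that for each $i$ the leading vertex of $f_i$ is the monomial exposed in the $i$-th coincidence, is a basis of $M$.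
   Context: Modules are right modules. $\mathcal{A}^m$ is the free right $\mathcal{A}$-module with basis $e_1,\ldots,e_m$; its elements are finite $K$-linear combinations of monomials $e_iz$ ($1\le i\le m$, $z\in\mathbf{F}$). The monomials are identified with the vertices of $m$ disjoint copies $\mathcal{C}_1,\ldots,\mathcal{C}_m$ of the right Cayley graph of $\mathbf{F}$ with respect to $B$: the vertices of $\mathcal{C}_i$ are $\{e_iz\}_{z\in\mathbf{F}}$, with an edge labeled $b$ from $e_iz$ to $e_izb$ for $b\in B\cup B^{-1}$ (the $b^{-1}$-edge being the reverse of the $b$-edge). By a theorem of Cohn and Lewin, every submodule $M$ of $\mathcal{A}^m$ is free, with all bases of the same cardinality $\mathrm{rk}\,M$. For a set $S$ of monomials, $M|_S$ is the $K$-vector space of elements of $M$ whose support is contained in $S$. An exploration of $\mathbb{T}$ is a linear ordering $v_1,v_2,\ldots,v_n$ of all its vertices such that every vertex is either a neighbour in $\mathbb{T}$ of a smaller vertex, or is the first vertex in its tree $T_i$. Exposing $M$ along $\mathbb{T}$ means going over $v_1,\ldots,v_n$ in order; step $t$ exposes $v_t$. Step $t$ is classified as follows. If $v_t$ is a neighbour of a (necessarily unique) already-exposed vertex $u\in\{v_1,\ldots,v_{t-1}\}$, with the edge from $u$ to $v_t$ labeled by $b\in B\cup B^{-1}$, let $D_b^t$ be the set of vertices $x\in\{v_1,\ldots,v_t\}$ whose outgoing $b$-edge leads to a vertex of $\{v_1,\ldots,v_t\}$ (so $u\in D_b^t$); step $t$ is forced if $M|_{D_b^t}$ contains an element with $u$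 in its support. If $v_t$ is the first vertex exposed in its tree, step $t$ is not forced. A step which is not forced is a coincidence if there is an element of $M|_{\{v_1,\ldots,v_t\}}$ with $v_t$ in its support, and otherwise it is free. The leading vertex of a nonzero element supported on $\mathbb{T}$ is the largest vertex in its support with respect to the exploration order. *)

(* Defs.v *)
From HB Require Import structures.
From mathcomp Require Import all_boot all_order all_algebra.
From mathcomp Require Import finmap.
From mathcomp Require Import monalg.
From mathcomp Require Import boolp classical_sets functions cardinality.

Set Implicit Arguments.
Unset Strict Implicit.
Unset Printing Implicit Defensive.

Import GRing.Theory.

Local Open Scope classical_set_scope.
Local Open Scope ring_scope.

(* The free group on B, as reduced words. *)

Section FreeGroup.
Variable B : finType.

(* (b, true) stands for b and (b, false) for b^-1 *)
Definition letter : Type := (B * bool)%type.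

Definition linv (l : letter) : letter := (l.1, ~~ l.2).

Definition reduced (w : seq letter) : bool :=
  sorted (fun a b => b != linv a) w.

Record free_group := FreeGroup { word :> seq letter; _ : reduced word }.

HB.instance Definition _ := [isSub for word].
HB.instance Definition _ := [Choice of free_group by <:].

Definition cons_word (a : letter) (w : seq letter) : seq letter :=
  if w is b :: w' then if b == linv a then w' else a :: w else [:: a].

(* the reduced form of u ++ w, for w reduced *)
Definition mul_word (u w : seq letter) : seq letter := foldr cons_word w u.

Lemma linvK : involutive linv.
Proof. by case=> b e; rewrite /linv negbK. Qed.

Lemma reduced_behead a w : reduced (a :: w) -> reduced w.
Proof. exact: path_sorted. Qed.

Lemma cons_reduced a w : reduced w -> reduced (cons_word a w).
Proof.
case: w => [//|b w] /= rw; case: ifP => [_|/negbT ba]; first exact: path_sorted rw.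
by rewrite /reduced /= ba.
Qed.

Lemma mul_reduced u w : reduced w -> reduced (mul_word u w).
Proof. by move=> rw; elim: u => //= a u; exact: cons_reduced. Qed.

Lemma cons_word_id a w : reduced (a :: w) -> cons_word a w = a :: w.
Proof. by case: w => [//|b w] /= /andP[/negbTE ->]. Qed.

Lemma cons_wordK a w : reduced w -> cons_word (linv a) (cons_word a w) = w.
Proof.
case: w => [|b w] rw /=; first by rewrite linvK eqxx.
case: eqP => [eb|_] /=; last by rewrite linvK eqxx.
by rewrite -eb cons_word_id.
Qed.

Lemma mul_cons a u w : reduced w ->
  mul_word (cons_word a u) w = cons_word a (mul_word u w).
Proof.
case: u => [//|b u] rw /=; case: eqP => [->|_ //].
by rewrite -{1}(linvK a) cons_wordK ?mul_reduced.
Qed.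

Lemma mul_wordA u v w : reduced w ->
  mul_word u (mul_word v w) = mul_word (mul_word u v) w.
Proof. by move=> rw; elim: u => //= a u ->; rewrite mul_cons. Qed.

Lemma mul_word0 u : reduced u -> mul_word u [::] = u.
Proof.
elim: u => //= a u IHu ru; rewrite IHu ?cons_word_id //.
exact: reduced_behead ru.
Qed.

Definition inv_word (u : seq letter) : seq letter := rev (map linv u).

Lemma inv_reduced u : reduced u -> reduced (inv_word u).
Proof.
rewrite /reduced /inv_word rev_sorted sorted_map; apply: sub_sorted => a b.
by rewrite /= linvK eq_sym (inv_eq linvK).
Qed.

Lemma mul_inv_word u : reduced u -> mul_word (inv_word u) u = [::].
Proof.
elim: u => //= a u IHu ru; rewrite /inv_word /= rev_cons /mul_word foldr_rcons /=.
by rewrite linvK eqxx; apply: IHu; exact: reduced_behead ru.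
Qed.

Lemma inv_wordK : involutive inv_word.
Proof. by move=> u; rewrite /inv_word map_rev revK mapK //; exact: linvK. Qed.

Definition fg_one : free_group := @FreeGroup [::] isT.
Definition fg_mul (x y : free_group) : free_group :=
  FreeGroup (mul_reduced x (valP y)).
Definition fg_inv (x : free_group) : free_group :=
  FreeGroup (inv_reduced (valP x)).

Lemma fg_mulA : associative fg_mul.
Proof. by move=> x y z; apply: val_inj; apply: mul_wordA; exact: valP z. Qed.
Lemma fg_mul1 : left_id fg_one fg_mul.
Proof. by move=> x; apply: val_inj. Qed.
Lemma fg_mulr1 : right_id fg_one fg_mul.
Proof. by move=> x; apply: val_inj; apply: mul_word0; exact: valP x. Qed.
Lemma fg_mulV : left_inverse fg_one fg_inv fg_mul.
Proof. by move=> x; apply: val_inj; apply: mul_inv_word; exact: valP x. Qed.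
Lemma fg_mulrV : right_inverse fg_one fg_inv fg_mul.
Proof.
move=> x; apply: val_inj; rewrite /= -{1}[word x]inv_wordK.
by apply: mul_inv_word; apply: inv_reduced; exact: valP x.
Qed.

HB.instance Definition _ :=
  isGroup.Build free_group fg_mulA fg_mul1 fg_mulr1 fg_mulV fg_mulrV.

Definition gen (l : letter) : free_group := @FreeGroup [:: l] isT.

End FreeGroup.

(* The group algebra K[G].  Only finitely supported functions are taken from
   monalg: its product requires monoids in which 1 is the only unit. *)

Definition group_alg (K : nzRingType) (G : groupType) : Type := {malg K[G]}.

Section GroupAlgebra.
Variables (K : nzRingType) (G : groupType).
Local Notation A := (group_alg K G).

HB.instance Definition _ := GRing.Zmodule.on A.

Definition ga_one : A := << 1 *g 1%g >>.

Definition ga_mul (g h : A) : A :=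
  \sum_(x <- msupp g) \sum_(y <- msupp h) << g@_x * h@_y *g (x * y)%g >>.

Lemma ga_mulw (d1 d2 : {fset G}) (g h : A) :
  (msupp g `<=` d1)%fset -> (msupp h `<=` d2)%fset ->
  ga_mul g h = \sum_(x <- d1) \sum_(y <- d2) << g@_x * h@_y *g (x * y)%g >>.
Proof.
move=> le_d1 le_d2; rewrite /ga_mul (big_fset_incl _ le_d1) /=.
  apply/eq_bigr=> k1 _; apply/big_fset_incl => // k _ /mcoeff_outdom ->.
  by rewrite mulr0 monalgU0.
move=> k _ /mcoeff_outdom g1k.
by rewrite big1 => // k' _; rewrite g1k mul0r monalgU0.
Qed.

Lemma ga_mulUU c1 c2 k1 k2 :
  ga_mul << c1 *g k1 >> << c2 *g k2 >> = << c1 * c2 *g (k1 * k2)%g >>.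
Proof. by rewrite (ga_mulw msuppU_le msuppU_le) !big_seq_fset1 !mcoeffUU. Qed.

Lemma ga_mulDl : left_distributive ga_mul +%R.
Proof.
move=> g1 g2 g.
rewrite (ga_mulw (msuppD_le g1 g2) (fsubset_refl _)).
rewrite (ga_mulw (fsubsetUl (msupp g1) (msupp g2)) (fsubset_refl (msupp g))).
rewrite (ga_mulw (fsubsetUr (msupp g1) (msupp g2)) (fsubset_refl (msupp g))).
rewrite -big_split /=; apply/eq_bigr=> k1 _.
rewrite -big_split /=; apply/eq_bigr=> k2 _.
by rewrite mcoeffD mulrDl monalgUD.
Qed.

Lemma ga_mulDr : right_distributive ga_mul +%R.
Proof.
move=> g g1 g2.
rewrite (ga_mulw (fsubset_refl _) (msuppD_le g1 g2)).
rewrite (ga_mulw (fsubset_refl (msupp g)) (fsubsetUl (msupp g1) (msupp g2))).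
rewrite (ga_mulw (fsubset_refl (msupp g)) (fsubsetUr (msupp g1) (msupp g2))).
rewrite -big_split /=; apply/eq_bigr=> k1 _.
rewrite -big_split /=; apply/eq_bigr=> k2 _.
by rewrite mcoeffD mulrDr monalgUD.
Qed.

Lemma ga_mul0 : left_zero 0 ga_mul.
Proof. by move=> g; rewrite /ga_mul msupp0 big_seq_fset0. Qed.

Lemma ga_mulr0 : right_zero 0 ga_mul.
Proof.
by move=> g; rewrite /ga_mul msupp0 big1 // => x _; rewrite big_seq_fset0.
Qed.

Lemma ga_mul_suml I (r : seq I) (F : I -> A) (h : A) :
  ga_mul (\sum_(i <- r) F i) h = \sum_(i <- r) ga_mul (F i) h.
Proof. exact: (big_morph (ga_mul^~ h) (fun x y => ga_mulDl x y h) (ga_mul0 h)). Qed.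

Lemma ga_mul_sumr I (r : seq I) (F : I -> A) (h : A) :
  ga_mul h (\sum_(i <- r) F i) = \sum_(i <- r) ga_mul h (F i).
Proof. exact: (big_morph (ga_mul h) (ga_mulDr h) (ga_mulr0 h)). Qed.

Lemma ga_mul1 : left_id ga_one ga_mul.
Proof.
move=> g; rewrite [LHS](congr1 (ga_mul _) (monalgE g)) ga_mul_sumr.
rewrite [RHS]monalgE; apply: eq_bigr => x _.
by rewrite ga_mulUU mul1r mul1g.
Qed.

Lemma ga_mulr1 : right_id ga_one ga_mul.
Proof.
move=> g; rewrite [LHS](congr1 (ga_mul^~ _) (monalgE g)) ga_mul_suml.
rewrite [RHS]monalgE; apply: eq_bigr => x _.
by rewrite ga_mulUU mulr1 mulg1.
Qed.

Lemma ga_mulA : associative ga_mul.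
Proof.
pose D (u : A) := \sum_(x <- msupp u) (<< u@_x *g x >> : A).
have DE u : u = D u by exact: monalgE.
move=> f g h; rewrite (DE f) (DE g) (DE h) /D.
rewrite !ga_mul_suml; apply: eq_bigr => x _.
rewrite [LHS]ga_mul_sumr [X in _ = ga_mul X _]ga_mul_sumr ga_mul_suml.
apply: eq_bigr => y _.
rewrite !ga_mul_sumr; apply: eq_bigr => z _.
by rewrite !ga_mulUU mulrA mulgA.
Qed.

Lemma ga_one_neq0 : ga_one != 0.
Proof. by rewrite monalgU_eq0 oner_eq0. Qed.

HB.instance Definition _ := GRing.Zmodule_isNzRing.Build A
  ga_mulA ga_mul1 ga_mulr1 ga_mulDl ga_mulDr ga_one_neq0.

End GroupAlgebra.

(* Right A-modules are left modules over the converse ring A^c: in 'rV[A^c]_m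
   the scalar product a *: v is (v_1 * a, ..., v_m * a). *)

Section RightModules.
Variables (A : nzRingType) (V : lmodType A^c).

Definition is_submodule (M : set V) : Prop :=
  [/\ M 0, forall u v, M u -> M v -> M (u + v)
    & forall (a : A^c) u, M u -> M (a *: u)].

Definition mspan (S : set V) : set V :=
  [set v | exists (s : seq V) (c : V -> A^c),
     (forall x, x \in s -> S x) /\ v = \sum_(x <- s) c x *: x].

Definition lin_indep (S : set V) : Prop :=
  forall (s : seq V) (c : V -> A^c), uniq s -> (forall x, x \in s -> S x) ->
    \sum_(x <- s) c x *: x = 0 -> forall x, x \in s -> c x = 0.

Definition is_basis (M S : set V) : Prop := mspan S = M /\ lin_indep S.

(* M is free and r is the common cardinality of all its bases. *)
Definition has_rank (M : set V) (r : nat) : Prop :=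
  (exists S, is_basis M S) /\ (forall S, is_basis M S -> (S #= `I_r)%card).

End RightModules.

(* The subgraph of e induced on the finite set S is a tree: any two vertices
   are joined by exactly one simple path.  The empty set is allowed. *)
Definition induces_tree (V : choiceType) (e : rel V) (S : {fset V}) : Prop :=
  forall x y, x \in S -> y \in S ->
    exists! p : seq V, [/\ path e x p, last x p = y, uniq (x :: p)
                         & {subset p <= S}].

Definition cayley_adj (B : finType) : rel (free_group B) :=
  fun x y => [exists l : letter B, y == (x * gen l)%g].

(* As the Cayley graph is a tree, a subtree of it is an induced subgraph and is
   given by its set of vertices. *)
Definition is_subtree (B : finType) (S : {fset free_group B}) : Prop :=
  induces_tree (@cayley_adj B) S.

Section Exposure.
Variables (K : nzRingType) (B : finType) (m : nat).

Definition free_module : Type := 'rV[(group_alg K (free_group B))^c]_m.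
HB.instance Definition _ := GRing.Lmodule.on free_module.

(* (i, z) stands for the monomial e_i z *)
Definition vertex : Type := ('I_m * free_group B)%type.
HB.instance Definition _ := Choice.on vertex.

Definition coef (f : free_module) (v : vertex) : K :=
  (f 0 v.1 : group_alg K (free_group B))@_(v.2).

Definition supp (f : free_module) : pred vertex := fun v => coef f v != 0.

Definition step (v : vertex) (l : letter B) : vertex := (v.1, (v.2 * gen l)%g).

Definition adj (u v : vertex) : bool := [exists l : letter B, v == step u l].

Definition in_forest (T : 'I_m -> {fset free_group B}) : pred vertex :=
  fun v => v.2 \in T v.1.

Definition supported (S : pred vertex) (f : free_module) : Prop :=
  {subset supp f <= S}.

Definition restr (M : set free_module) (S : pred vertex) : set free_module :=
  [set f | M f /\ supported S f].

(* In an ordering vs of distinct vertices, the vertices exposed before v, and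
   those exposed once v has been. *)
Definition before (vs : seq vertex) (v : vertex) : seq vertex :=
  take (index v vs) vs.
Definition upto (vs : seq vertex) (v : vertex) : seq vertex :=
  take (index v vs).+1 vs.

Definition exploration (T : 'I_m -> {fset free_group B}) (vs : seq vertex) :
    Prop :=
  [/\ uniq vs, vs =i in_forest T
    & forall v, v \in vs -> (exists2 u, u \in before vs v & adj u v) \/
                            (forall u, u \in before vs v -> u.1 != v.1)].

Section Steps.
Variables (M : set free_module) (vs : seq vertex).

Definition Dset (v : vertex) (l : letter B) : pred vertex :=
  fun x => (x \in upto vs v) && (step x l \in upto vs v).

(* The first vertex of a tree has no neighbour u among those exposed before. *)
Definition forced (v : vertex) : Prop :=
  exists (u : vertex) (l : letter B),
    [/\ u \in before vs v, v = step u l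
      & exists2 f, restr M (Dset v l) f & u \in supp f].

Definition coincidence (v : vertex) : Prop :=
  ~ forced v /\ exists2 f, restr M (mem (upto vs v)) f & v \in supp f.

(* The vertices exposed in the coincidences, in the order of exposure. *)
Definition coincidences : seq vertex := [seq v <- vs | `[< coincidence v >]].

End Steps.

Definition is_leading (vs : seq vertex) (f : free_module) (v : vertex) : Prop :=
  v \in supp f /\ forall w, w \in supp f -> (index w vs <= index v vs)%N.

End Exposure.

(* Main.v *)
Require Import Defs.
From HB Require Import structures.
From mathcomp Require Import all_boot all_order all_algebra.
From mathcomp Require Import finmap.
From mathcomp Require Import monalg.
From mathcomp Require Import boolp classical_sets functions cardinality.

(** Write the right action of the group algebra on the free module by
    juxtaposition, and let f_v in M be supported on the vertices exposed up to
    v with v in its support, one for each coincidence v.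

    That the f_v generate M is a reduction argument: an element of M supported
    on the exposed vertices can have its last vertex v cancelled by a scalar
    multiple of f_v when v is a coincidence, and by a scalar multiple of h b
    when v is forced by an h in M supported on D_b; such an h lives on earlier
    vertices, so h, and hence h b, was already generated. At a free step the
    last vertex does not occur at all (coincidences_generate).

    For independence, fix a right module N and a target e_v in N for every
    coincidence v. There is a K-linear map delta into N that sends f_v to e_v
    and commutes with a letter b on every element of M supported on D_b, where
    the domain D_b consists of the exposed x with x b exposed (equivariant_map).
    It is built along the exploration. A new vertex v has at most one exposed
    neighbour, because the Cayley graph is a tree, so exposing v = u b enlarges
    the domains of b and b^-1 only, and only by u and v. The commutation
    requirement is therefore new only for the elements of M on D_b having u in
    their support and for their translates by b, and they exist exactly when the step is forced. If so, one of
    them dictates how delta should be changed along the coordinate of v, and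
    linearity gives the others; otherwise the change of delta along that
    coordinate is arbitrary and can be used to send f_v to e_v.

    The construction applies to every exploration, also to one that leaves the
    forest on which M is generated. Given a relation between the f_v, continue
    the exploration until it contains all the translates of the forest by the
    prefixes of the words occurring in the coefficients (explored_ball). Then
    delta commutes with these coefficients on the f_v, and taking N to be the
    group algebra, e_v = 1 for a single v and 0 for the others, shows that the
    coefficient of f_v vanishes (coincidences_indep).

    Finally all bases of M have the same size as this finite one: the
    augmentation maps the group algebra to a field and turns mutually inverse
    changes of bases into mutually inverse matrices (has_rank_seq). *)

Set Implicit Arguments.
Unset Strict Implicit.
Unset Printing Implicit Defensive.

Import GRing.Theory.

Local Open Scope classical_set_scope.
Local Open Scope ring_scope.

(** * Words in the free group *)

Section Words.
Variable B : finType.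
Implicit Types (l : letter B) (w : seq (letter B)) (x z : free_group B).

Definition wordg w : free_group B := foldr (fun l z => gen l * z)%g 1%g w.

Lemma wordg_rcons w l : wordg (rcons w l) = (wordg w * gen l)%g.
Proof. by elim: w => [|a w IHw] /=; rewrite ?mul1g ?mulg1 // IHw mulgA. Qed.

Lemma wordgK z : wordg (word z) = z.
Proof.
apply: val_inj; case: z => w; elim: w => //= a w IHw rw.
rewrite /wordg /= -/(wordg w) IHw ?cons_word_id //; exact: reduced_behead rw.
Qed.

Lemma genV l : (gen l)^-1%g = gen (linv l).
Proof. exact: val_inj. Qed.

Lemma gen_mulV l : (gen l * gen (linv l))%g = 1%g.
Proof. by rewrite -genV mulgV. Qed.

Lemma linv_neq l : linv l != l.
Proof. by case: l => b []; rewrite /linv xpair_eqE andbF. Qed.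

Lemma word_eq0 z : (word z == [::]) = (z == 1%g).
Proof. by apply/eqP/eqP => [e|-> //]; apply: val_inj. Qed.

Lemma ohead_mul_word u l : mul_word u [:: l] != [::] -> u != [::] ->
  reduced u -> ohead (mul_word u [:: l]) = ohead u.
Proof.
elim: u => // a [|b u] IHu; first by rewrite /=; case: (l == linv a).
move=> _ _ /[dup] /andP[ba _] /reduced_behead rb.
have {IHu} := IHu _ isT rb.
rewrite -[mul_word (a :: _) _]/(cons_word a (mul_word (b :: u) [:: l])).
case: (mul_word (b :: u) _) => [_ //|c w /(_ isT) [->] /=].
by rewrite (negbTE ba).
Qed.

(** Away from 1, an edge of the Cayley graph does not change the first letter
    of the reduced word: right multiplication only acts on its last letter. The
    first letter thus names the component of the graph minus 1. *)
Lemma ohead_step z l : z != 1%g -> (z * gen l)%g != 1%g ->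
  ohead (word (z * gen l)%g) = ohead (word z).
Proof.
rewrite -!word_eq0 => z1 zl1; apply: ohead_mul_word => //.
exact: (valP z).
Qed.

End Words.

(** * The action of the group algebra on the free module *)

(** The converse ring and the free module are bundled with their structures
    once and for all, and monomials are sealed: otherwise comparing two scalar
    multiples unfolds the converse ring and finitely supported functions. *)
Definition galgc (K : fieldType) (B : finType) : nzRingType :=
  (group_alg K (free_group B))^c.

Definition fmod (K : fieldType) (B : finType) (m : nat) :
    lmodType (galgc K B) :=
  free_module K B m.

HB.lock Definition monom (K : fieldType) (B : finType) (c : K)
    (z : free_group B) : galgc K B :=
  (<< c *g z >> : group_alg K (free_group B)).

Section Action.
Variables (K : fieldType) (B : finType) (m : nat).
Local Notation A := (group_alg K (free_group B)).

Local Notation galgc := (galgc K B).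
Local Notation fmod := (fmod K B m).

Lemma monomU (c : K) (z : free_group B) : monom c z = (<< c *g z >> : A) :> A.
Proof. by rewrite monom.unlock. Qed.

Lemma monomM (c1 c2 : K) (z1 z2 : free_group B) :
  monom c1 z1 * monom c2 z2 = monom (c1 * c2) (z2 * z1)%g.
Proof. by rewrite !monomU mulrC; exact: ga_mulUU. Qed.

Lemma monomE (a : galgc) : a = \sum_(z <- msupp (a : A)) monom (a : A)@_z z.
Proof. by under eq_bigr do rewrite monomU; exact: (monalgE (a : A)). Qed.

Lemma mcoef_mulg (g : A) (c : K) (z x : free_group B) :
  (g * (monom c z : A))@_x = g@_(x * z^-1)%g * c.
Proof.
rewrite monomU [in LHS](monalgE g) mulr_suml raddf_sum /=.
under eq_bigr => y _.
  rewrite [_ * _]ga_mulUU mcoeffU -(can_eq (mulgK z^-1%g)) mulgK; over.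
rewrite [in RHS](monalgE g) raddf_sum /= mulr_suml.
by apply: eq_bigr => y _; rewrite mcoeffU mulrnAl.
Qed.

Lemma coef_monomZ (c : K) (z : free_group B) (f : fmod) v :
  coef (monom c z *: f) v = coef f (v.1, (v.2 * z^-1)%g) * c.
Proof. by rewrite /coef mxE; exact: mcoef_mulg. Qed.

Lemma coef_add (f g : fmod) v : coef (f + g) v = coef f v + coef g v.
Proof. by rewrite /coef mxE; exact: mcoeffD. Qed.

End Action.

(** * Explorations in the forest of Cayley graphs *)

Section Exploring.
Variables (B : finType) (m : nat).
Local Notation vertex := (vertex B m).
Implicit Types (u v w x y : vertex) (vs : seq vertex) (l : letter B).

(** An exploration of the subforest formed by its own vertices: independence is
    proved by moving beyond any given forest. *)
Definition explored vs : Prop :=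
  uniq vs /\ forall v, v \in vs ->
    (exists2 u, u \in before vs v & adj u v) \/
    (forall u, u \in before vs v -> u.1 != v.1).

Lemma before_cat vs s v : v \in vs -> before (vs ++ s) v = before vs v.
Proof.
by move=> vvs; rewrite /before index_cat vvs takel_cat // ltnW ?index_mem.
Qed.

Lemma upto_cat vs s v : v \in vs -> upto (vs ++ s) v = upto vs v.
Proof. by move=> vvs; rewrite /upto index_cat vvs takel_cat // index_mem. Qed.

Lemma before_last vs v : v \notin vs -> before (rcons vs v) v = vs.
Proof.
move=> vvs; rewrite /before -cats1 index_cat (negbTE vvs) /= eqxx addn0.
by rewrite take_size_cat.
Qed.

Lemma upto_last vs v : v \notin vs -> upto (rcons vs v) v = rcons vs v.
Proof.
move=> vvs; rewrite /upto -cats1 index_cat (negbTE vvs) /= eqxx addn0.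
by rewrite take_oversize // size_cat /= addn1.
Qed.

Lemma explored_rcons vs v : explored (rcons vs v) <->
  [/\ explored vs, v \notin vs
    & (exists2 u, u \in vs & adj u v) \/ (forall u, u \in vs -> u.1 != v.1)].
Proof.
split=> [[]|[[uvs vsP] vvs vP]]; rewrite /explored rcons_uniq.
  move=> /andP[vvs uvs] vsP; split=> //; last first.
    by have := vsP v; rewrite before_last // mem_rcons mem_head; apply.
  split=> // w wvs; rewrite -(before_cat [:: v] wvs) cats1.
  by apply: vsP; rewrite mem_rcons inE wvs orbT.
rewrite vvs; split=> // w; rewrite mem_rcons inE => /predU1P[->|wvs].
  by rewrite before_last.
by rewrite -cats1 before_cat //; exact: vsP.
Qed.

Lemma adjP u v : reflect (exists l, v = step u l) (adj u v).
Proof.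
by apply: (iffP existsP) => -[l /eqP h]; exists l => //; apply/eqP.
Qed.

Lemma stepK v l : step (step v l) (linv l) = v.
Proof. by case: v => i z; rewrite /step /= -mulgA gen_mulV mulg1. Qed.

Lemma stepVK v l : step (step v (linv l)) l = v.
Proof. by rewrite -{2}(linvK l) stepK. Qed.

Lemma step_neq v l : step v l != v.
Proof.
case: v => i z; apply/eqP => -[]; rewrite -[RHS]mulg1.
by move=> /mulgI /(congr1 (@word B)).
Qed.

Lemma vertex_eq u v : u.1 = v.1 -> u.2 = v.2 -> u = v.
Proof. by case: u v => i a [j b] /= -> ->. Qed.

Lemma step2 v l : (step v l).2 = (v.2 * gen l)%g.
Proof. by []. Qed.

(** The explored part of a copy is connected, so if it avoids v then it lies
    in one component of the graph minus v; components are told apart by the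
    first letter after translating v to 1. *)
Lemma same_side vs v x y : explored vs -> v \notin vs ->
  x \in vs -> y \in vs -> x.1 = v.1 -> y.1 = v.1 ->
  ohead (word (v.2^-1 * x.2)%g) = ohead (word (v.2^-1 * y.2)%g).
Proof.
elim/last_ind: vs x y => // vs w IHvs x y /explored_rcons[evs wvs wP].
rewrite mem_rcons inE negb_or => /andP[vw vvs].
have wy z : z \in vs -> w.1 = v.1 -> z.1 = v.1 ->
    ohead (word (v.2^-1 * w.2)%g) = ohead (word (v.2^-1 * z.2)%g).
  move=> zvs w1 z1; case: wP => [[u uvs /adjP[l wE]]|]; last first.
    by move=> /(_ _ zvs); rewrite w1 z1 eqxx.
  have u1 : u.1 = v.1 by rewrite -w1 wE.
  rewrite -(IHvs u z) // wE step2 mulgA ohead_step //.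
    apply: contraNneq vvs => /mulg1_eq; rewrite invgK => e.
    by rewrite -(vertex_eq u1 (esym e)).
  rewrite -mulgA -step2 -wE; apply: contraNneq vw => /mulg1_eq.
  rewrite invgK => e.
  by rewrite -(vertex_eq w1 (esym e)).
rewrite !mem_rcons !inE => /predU1P[->|xvs] /predU1P[->|yvs] // x1 y1.
- exact: wy.
- by rewrite -wy.
- exact: IHvs.
Qed.

(** Two neighbours of v in the same component of the graph minus v start,
    seen from v, with the same letter. *)
Lemma unique_neighbour vs v x y l l' : explored vs -> v \notin vs ->
  x \in vs -> y \in vs -> v = step x l -> v = step y l' -> x = y /\ l = l'.
Proof.
move=> evs vvs xvs yvs vx vy.
have back z k : v = step z k -> (v.2^-1 * z.2)%g = gen (linv k).
  by move=> ->; rewrite step2 invgM -mulgA mulVg mulg1 genV.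
have x1 : x.1 = v.1 by rewrite vx.
have y1 : y.1 = v.1 by rewrite vy.
have := same_side evs vvs xvs yvs x1 y1.
rewrite (back x l) // (back y l') // => -[e1 e2].
have ll' : l = l' by case: (l) (l') e1 e2 => b1 c1 [b2 c2] /= -> /negb_inj ->.
by split=> //; rewrite -[x](stepK x l) -vx vy ll' stepK.
Qed.

End Exploring.

(** * Partially equivariant linear maps *)

Section Equivariance.
Variables (K : fieldType) (B : finType) (m : nat).
Local Notation R := (galgc K B).
Local Notation V := (fmod K B m).
Local Notation vertex := (vertex B m).
Implicit Types (u v w x : vertex) (vs : seq vertex) (l : letter B).
Implicit Types (f g h : V) (k : K).

Definition scal k : R := monom k 1%g.
Definition letterm l : R := monom 1 (gen l).

Lemma scal1 : scal 1 = 1. Proof. exact: monomU. Qed.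

Lemma scalM k k' : scal k * scal k' = scal (k * k').
Proof. by rewrite [LHS]monomM mulg1. Qed.

Lemma scalC k (a : R) : scal k * a = a * scal k.
Proof.
rewrite [a]monomE mulr_sumr mulr_suml; apply: eq_bigr => z _.
by rewrite !monomM mulg1 mul1g mulrC.
Qed.

Lemma letterK l : letterm (linv l) * letterm l = 1.
Proof. by rewrite [LHS]monomM gen_mulV mulr1 monomU. Qed.

Lemma letterVK l : letterm l * letterm (linv l) = 1.
Proof. by rewrite -{1}(linvK l) letterK. Qed.

Lemma letter_lin (W : lmodType R) l k (p q : W) :
  letterm l *: (p + scal k *: q) = letterm l *: p + scal k *: (letterm l *: q).
Proof. by rewrite scalerDr 2!scalerA -scalC. Qed.

Definition klinear (W N : lmodType R) (delta : W -> N) : Prop :=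
  forall k p q, delta (p + scal k *: q) = delta p + scal k *: delta q.

Lemma klinear_commute (W N : lmodType R) (delta : W -> N) l k p q :
  klinear delta ->
  delta (letterm l *: p) = letterm l *: delta p ->
  delta (letterm l *: q) = letterm l *: delta q ->
  delta (letterm l *: (p + scal k *: q)) = letterm l *: delta (p + scal k *: q).
Proof. by move=> dlin dp dq; rewrite letter_lin !dlin dp dq letter_lin. Qed.

Lemma coef_scal k f v : coef (scal k *: f) v = k * coef f v.
Proof. by rewrite coef_monomZ invg1 mulg1 mulrC; case: v. Qed.

Lemma coef_letter l f v : coef (letterm l *: f) (step v l) = coef f v.
Proof. by rewrite coef_monomZ mulr1 /= mulgK; case: v. Qed.

Lemma coef_letterV l f v : coef (letterm l *: f) v = coef f (step v (linv l)).
Proof. by rewrite -{1}(stepVK v l) coef_letter. Qed.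

Lemma scalD k k' : scal (k + k') = scal k + scal k'.
Proof. by rewrite /scal !monomU; exact: monalgUD. Qed.

Lemma scal0 : scal 0 = 0.
Proof. by rewrite /scal monomU; exact: monalgU0. Qed.

Lemma subr_scalK (W : lmodType R) k (p q : W) :
  p + scal (- k) *: q + scal k *: q = p.
Proof. by rewrite -addrA -scalerDl -scalD addNr scal0 scale0r addr0. Qed.

(** The domain D_l once the vertices of vs, and no others, are exposed. *)
Definition dom vs l : pred vertex := fun x => (x \in vs) && (step x l \in vs).

Lemma in_dom vs l x : (x \in dom vs l) = (x \in vs) && (step x l \in vs).
Proof. by []. Qed.

Lemma in_supp f x : (x \in supp f) = (coef f x != 0).
Proof. by []. Qed.

Lemma supported_letter vs l g : supported (dom vs l) g ->
  supported (dom vs (linv l)) (letterm l *: g).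
Proof.
move=> sg x; rewrite in_supp coef_letterV => /sg.
by rewrite !in_dom stepVK andbC.
Qed.

Lemma supported_lin (S : pred vertex) k g h :
  supported S g -> supported S h -> supported S (g + scal k *: h).
Proof.
move=> sg sh x; rewrite in_supp coef_add coef_scal => nz.
have [gx|/sg //] := eqVneq (coef g x) 0; apply: sh.
by apply: contraNneq nz => hx; rewrite gx hx mulr0 addr0.
Qed.

(** In this section v has just been exposed, hence is a leaf of the explored
    forest. *)
Section Leaf.
Variables (vs : seq vertex) (v : vertex).
Hypothesis evs : explored (rcons vs v).

Let vvs : v \notin vs. Proof. by case/explored_rcons: evs. Qed.
Let evs0 : explored vs. Proof. by case/explored_rcons: evs. Qed.

(** A second edge labelled l leaving v would lead back to the only neighbour
    of v, so l would be its own inverse. *)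
Lemma leaf_dom u l : u \in vs -> v = step u l -> v \notin dom (rcons vs v) l.
Proof.
move=> uvs vE; rewrite in_dom mem_rcons mem_head /=.
rewrite mem_rcons inE (negbTE (step_neq v l)) /=; apply/negP => vlvs.
have [_] := unique_neighbour evs0 vvs uvs vlvs vE (esym (stepK v l)).
by move/eqP; rewrite eq_sym (negbTE (linv_neq l)).
Qed.

Lemma coef_leaf u l g : u \in vs -> v = step u l ->
  supported (dom (rcons vs v) l) g -> coef g v = 0.
Proof.
move=> uvs vE sg; apply/eqP; apply: contraNT (leaf_dom uvs vE); exact: sg.
Qed.

Lemma supported_old l g : supported (dom (rcons vs v) l) g ->
  coef g v = 0 -> coef (letterm l *: g) v = 0 -> supported (dom vs l) g.
Proof.
move=> sg gv glv x /[dup] /sg; rewrite in_supp !in_dom !mem_rcons !inE.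
case/andP => /predU1P[->|xvs]; first by rewrite gv eqxx.
move=> /predU1P[e|-> //]; last by rewrite xvs.
by rewrite -e coef_letter in glv; rewrite glv eqxx.
Qed.

End Leaf.

Variable N : lmodType R.
Implicit Type delta : V -> N.

(** Commutation with a letter is only asked for where multiplying by it stays
    inside the exposed vertices. *)
Definition equivariant (M : set V) vs delta : Prop :=
  forall l g, restr M (dom vs l) g ->
    delta (letterm l *: g) = letterm l *: delta g.

(** Changing delta along the coordinate of v does not affect what has been
    achieved for elements supported on earlier vertices. *)
Definition perturb delta v (y : N) : V -> N :=
  fun f => delta f + scal (coef f v) *: y.

Lemma klinear_perturb delta v y : klinear delta -> klinear (perturb delta v y).
Proof.
move=> dlin k f g; rewrite /perturb dlin coef_add coef_scal.
have -> : scal (coef f v + k * coef g v) *: y =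
    scal (coef f v) *: y + scal k *: (scal (coef g v) *: y).
  by rewrite scalD (scalerDl y) (scalerA (scal k)) scalM.
by rewrite addrACA -(scalerDr (scal k) (delta g)).
Qed.

Lemma perturb_eq delta v y f : coef f v = 0 -> perturb delta v y f = delta f.
Proof. by move=> fv; rewrite /perturb fv scal0 scale0r addr0. Qed.

Lemma perturb_exists delta v f (p : N) : v \in supp f ->
  exists y, perturb delta v y f = p.
Proof.
rewrite in_supp => fv; exists (scal (coef f v)^-1 *: (p - delta f)).
by rewrite /perturb scalerA scalM mulfV // scal1 scale1r addrC subrK.
Qed.

(** After exposing v, the only new requirements come from g in M such that
    the edge used by g or by its translate ends at v. Replacing g by its
    translate and the letter by its inverse, the edge may be assumed to lead
    from an older u to v. *)
Lemma equivariant_rcons (M : set V) vs v delta y :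
  is_submodule M -> explored (rcons vs v) -> equivariant M vs delta ->
  (forall u l g, u \in vs -> v = step u l ->
     restr M (dom (rcons vs v) l) g -> u \in supp g ->
     perturb delta v y (letterm l *: g) = letterm l *: perturb delta v y g) ->
  equivariant M (rcons vs v) (perturb delta v y).
Proof.
move=> [_ _ MZ] ev dM new l g [Mg sg].
have mem_old x : x != v -> x \in rcons vs v -> x \in vs.
  by rewrite mem_rcons inE => /negbTE ->.
have [glv|glv] := eqVneq (coef (letterm l *: g) v) 0; last first.
  have ug : step v (linv l) \in supp g by rewrite in_supp -coef_letterV.
  apply: (new (step v (linv l))) => //; last by rewrite stepVK.
  by apply: mem_old (step_neq _ _) _; case/andP: (sg _ ug).
have [gv|gv] := eqVneq (coef g v) 0.
  rewrite !perturb_eq //; apply: dM; split=> //.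
  exact: supported_old sg gv glv.
have vl : step v l \in vs.
  by apply: mem_old (step_neq _ _) _; case/andP: (sg v gv).
have glN : letterm (linv l) *: (letterm l *: g) = g.
  by rewrite scalerA letterK scale1r.
have gM : restr M (dom (rcons vs v) (linv l)) (letterm l *: g).
  by split; [exact: MZ | exact: supported_letter].
have glv' : step v l \in supp (letterm l *: g) by rewrite in_supp coef_letter.
have := new _ _ _ vl (esym (stepK v l)) gM glv'.
by rewrite glN => ->; rewrite (scalerA (letterm l)) letterVK scale1r.
Qed.

(** The coordinate of v is free to be chosen at each step: a forced step
    uses it to restore equivariance, a coincidence to prescribe the value. *)
Lemma equivariant_map (M : set V) vs (F : vertex -> V) (e : vertex -> N) :
  is_submodule M -> explored vs ->
  exists2 delta, klinear delta /\ equivariant M vs delta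
    & forall v, v \in vs -> coincidence M vs v -> v \in supp (F v) ->
        supported (mem (upto vs v)) (F v) -> delta (F v) = e v.
Proof.
move=> subM; elim/last_ind: vs => [_|vs v IHvs ev].
  exists (fun=> 0) => //; split=> [k f g|l g _]; by rewrite scaler0 ?addr0.
have [evs vvs _] := (explored_rcons vs v).1 ev.
have [delta [dlin dM] dF] := IHvs evs.
have [M0 MD MZ] := subM.
suff [y yM yF] : exists2 y,
    forall u l g, u \in vs -> v = step u l ->
      restr M (dom (rcons vs v) l) g -> u \in supp g ->
      perturb delta v y (letterm l *: g) = letterm l *: perturb delta v y g
  & coincidence M (rcons vs v) v -> v \in supp (F v) ->
      perturb delta v y (F v) = e v.
  exists (perturb delta v y).
    by split; [exact: klinear_perturb | exact: equivariant_rcons].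
  move=> w; rewrite mem_rcons inE => /predU1P[->|wvs]; first by move=> + + _.
  rewrite /coincidence /forced /Dset -cats1 before_cat // upto_cat //.
  move=> cw wF sF.
  rewrite perturb_eq; first exact: dF.
  apply/eqP; apply: contraNT vvs => /sF; exact: mem_take.
have [fv|nfv] := EM (forced M (rcons vs v) v); last first.
  have old u l g : u \in vs -> v = step u l ->
      restr M (dom (rcons vs v) l) g -> u \notin supp g.
    move=> uvs vE gM; apply/negP => ug; apply: nfv; exists u, l.
    rewrite before_last //; split=> //; exists g => //.
    by rewrite /Dset upto_last.
  have [vF|vF] := boolP (v \in supp (F v)).
    have [y yF] := perturb_exists delta (e v) vF.
    by exists y => // u l g uvs vE gM; rewrite (negbTE (old u l g uvs vE gM)).
  by exists 0 => // u l g uvs vE gM; rewrite (negbTE (old u l g uvs vE gM)).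
have [u0 [l0 [+ vE0 [h +]]]] := fv.
rewrite before_last // /Dset upto_last // => u0vs hM u0h.
have vh : v \in supp (letterm l0 *: h) by rewrite vE0 in_supp coef_letter.
have [y yh] := perturb_exists delta (letterm l0 *: delta h) vh.
exists y; last by move=> [].
move=> u l g uvs vE [Mg sg] ug; have [Mh sh] := hM.
have [eu el] := unique_neighbour evs vvs uvs u0vs vE vE0; subst u l.
have plin := klinear_perturb v y dlin.
have hv : coef h v = 0 := coef_leaf ev u0vs vE0 sh.
have {}yh : perturb delta v y (letterm l0 *: h) =
    letterm l0 *: perturb delta v y h.
  by rewrite yh perturb_eq.
(* g0 has no u0 in its support, so it was subject to equivariance before. *)
pose k := coef g u0 / coef h u0.
pose g0 := g + scal (- k) *: h.
have sg0 : supported (dom (rcons vs v) l0) g0 by exact: supported_lin.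
have g0v : coef g0 v = 0 := coef_leaf ev u0vs vE0 sg0.
have g0u : coef (letterm l0 *: g0) v = 0.
  by rewrite {1}vE0 coef_letter coef_add coef_scal mulNr divfK ?subrr.
have g0M : restr M (dom vs l0) g0.
  split; first by apply: MD => //; exact: MZ.
  exact: (supported_old (v := v)).
have g0E : perturb delta v y (letterm l0 *: g0) =
    letterm l0 *: perturb delta v y g0.
  by rewrite perturb_eq // perturb_eq //; exact: dM.
rewrite -(subr_scalK k g h); exact: klinear_commute.
Qed.

End Equivariance.

(** * Continuing an exploration *)

Section Growth.
Variables (B : finType) (m : nat).
Local Notation vertex := (vertex B m).
Implicit Types (u v x : vertex) (vs s : seq vertex) (l : letter B).

Definition translate x (z : free_group B) : vertex := (x.1, (x.2 * z)%g).

Lemma explored_step vs x l : explored vs -> x \in vs ->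
  exists2 s, explored (vs ++ s) & step x l \in vs ++ s.
Proof.
move=> evs xvs; have [xl|xl] := boolP (step x l \in vs).
  by exists [::]; rewrite cats0.
exists [:: step x l]; rewrite cats1; last by rewrite mem_rcons mem_head.
apply/explored_rcons; split=> //; left; exists x => //.
by apply/adjP; exists l.
Qed.

Lemma explored_steps vs (ps : seq (vertex * letter B)) : explored vs ->
  (forall p, p \in ps -> p.1 \in vs) ->
  exists2 s, explored (vs ++ s)
    & forall p, p \in ps -> step p.1 p.2 \in vs ++ s.
Proof.
move=> evs; elim: ps => [_|p ps IHps psvs].
  by exists [::]; rewrite ?cats0.
have [|s es sP] := IHps.
  by move=> q qps; apply: psvs; rewrite inE qps orbT.
have pvs : p.1 \in vs ++ s by rewrite mem_cat psvs ?mem_head.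
have [s' es' pP] := explored_step p.2 es pvs.
exists (s ++ s'); rewrite catA // => q; rewrite inE => /predU1P[->//|/sP].
by rewrite [in X in _ -> X]mem_cat => ->.
Qed.

Lemma explored_ball vs k : explored vs ->
  exists2 s, explored (vs ++ s) & forall x w, x \in vs -> (size w <= k)%N ->
    translate x (wordg w) \in vs ++ s.
Proof.
move=> evs; elim: k => [|k [s es sP]].
  exists [::]; rewrite cats0 // => x [|//] xvs _.
  by rewrite /translate mulg1 -surjective_pairing.
pose ps := [seq (x, l) | x <- vs ++ s, l <- enum {: B * bool}].
have [|s' es' s'P] := @explored_steps _ ps es.
  by move=> p /allpairsP[[x l] /= [xvs _ ->]].
exists (s ++ s'); rewrite catA // => x w xvs.
case/lastP: w => [_|w l]; first by rewrite mem_cat sP.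
rewrite size_rcons ltnS => wk.
have /s'P : (translate x (wordg w), l) \in ps.
  by apply/allpairsP; exists (translate x (wordg w), l); rewrite sP // mem_enum.
by rewrite /step /translate /= wordg_rcons mulgA.
Qed.

End Growth.

(** * Independence *)

Section Independence.
Variables (K : fieldType) (B : finType) (m : nat).
Local Notation R := (galgc K B).
Local Notation V := (fmod K B m).
Local Notation vertex := (vertex B m).
Implicit Types (u v x : vertex) (vs : seq vertex) (l : letter B).

Section KLinear.
Variables (W N : lmodType R) (delta : W -> N).
Hypothesis dlin : klinear delta.

Lemma klinearD : {morph delta : p q / p + q}.
Proof. by move=> p q; have := dlin 1 p q; rewrite scal1 !scale1r. Qed.

Lemma klinear0 : delta 0 = 0.
Proof. by apply: (addrI (delta 0)); rewrite -klinearD !addr0. Qed.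

Lemma klinearZ k p : delta (scal B k *: p) = scal B k *: delta p.
Proof. by have := dlin k 0 p; rewrite !(add0r, klinear0). Qed.

Lemma klinear_scale (a : R) p :
  (forall z, z \in msupp (a : group_alg K (free_group B)) ->
     delta (monom 1 z *: p) = monom 1 z *: delta p) ->
  delta (a *: p) = a *: delta p.
Proof.
move=> dz; rewrite [a]monomE !scaler_suml (big_morph delta klinearD klinear0).
apply: eq_big_seq => z /dz {}dz.
set k := mcoeff _ _; have -> : monom k z = scal B k * monom 1 z.
  by rewrite [RHS]monomM mulr1 mulg1.
by rewrite -!scalerA klinearZ dz.
Qed.

End KLinear.

(** As vs' contains the ball of radius k around vs, a word of length at most k
    can be applied letter by letter without leaving the domains on which delta
    commutes with letters. *)
Lemma equivariant_word (N : lmodType R) (M : set (free_module K B m)) vs vs' k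
    (delta : V -> N) (f : V) :
  is_submodule M -> equivariant M vs' delta ->
  (forall x w, x \in vs -> (size w <= k)%N -> translate x (wordg w) \in vs') ->
  M f -> supported (mem vs) f ->
  forall w, (size w <= k)%N ->
    delta (monom 1 (wordg w) *: f) = monom 1 (wordg w) *: delta f.
Proof.
move=> [_ _ MZ] dM ball Mf sf; elim/last_ind => [_|w l IHw].
  have -> : monom 1 (wordg [::]) = 1 :> R by exact: scal1.
  by rewrite !scale1r.
rewrite size_rcons => wk.
have -> : monom 1 (wordg (rcons w l)) = letterm K l * monom 1 (wordg w).
  by rewrite [RHS]monomM mulr1 wordg_rcons.
have {}IHw := IHw (ltnW wk).
rewrite -2!(scalerA (letterm K l) (monom 1 (wordg w))) -IHw.
apply: dM; split; first exact: MZ.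
move=> x; rewrite in_supp coef_monomZ mulr1 => /(sf (_, _)) xw.
rewrite in_dom; apply/andP; split.
  have := ball _ w xw (ltnW wk).
  by rewrite /translate /= -mulgA mulVg mulg1 -surjective_pairing.
have := ball _ (rcons w l) xw; rewrite size_rcons => /(_ wk).
by rewrite /translate /= wordg_rcons mulgA mulgVK.
Qed.

Lemma coincidence_cat (M : set (free_module K B m)) vs s v : v \in vs ->
  coincidence M (vs ++ s) v <-> coincidence M vs v.
Proof.
by move=> vvs; rewrite /coincidence /forced /Dset before_cat // upto_cat.
Qed.

(** The exploration is continued far enough for delta to commute with all the
    coefficients of a given relation. Whether a step is a coincidence only
    depends on the vertices exposed so far, so those of vs remain coincidences
    and delta keeps its prescribed values there. *)
Lemma coincidences_indep (M : set (free_module K B m)) vs (F : vertex -> V) :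
  is_submodule M -> explored vs ->
  (forall v, v \in coincidences M vs ->
     [/\ M (F v), v \in supp (F v) & supported (mem (upto vs v)) (F v)]) ->
  lin_indep [set F v | v in [set` coincidences M vs]].
Proof.
move=> subM evs FP s c us sS s0 x0 x0s.
pose k := (\max_(x <- s) \max_(z <- msupp (c x)) size (word z))%N.
have [s' es' ball] := explored_ball k evs.
pose N : lmodType R := R^o.
(* With these targets, applying delta to the relation isolates c x0. *)
pose e v : N := (F v == x0)%:R.
have [delta [dlin dM] dF] := equivariant_map F e subM es'.
have sP (x : V) : x \in s ->
    [/\ M x, supported (mem vs) x & delta x = (x == x0)%:R].
  move=> /sS [v vco <-]; have [Mv vF sF] := FP v vco.
  move: vco; rewrite /= mem_filter => /andP[/asboolP vco vvs].
  split=> //; first by move=> w /sF; exact: mem_take.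
  apply: dF => //; first by rewrite mem_cat vvs.
    exact/coincidence_cat.
  by rewrite upto_cat.
have dc (x : V) : x \in s -> delta (c x *: x) = c x *: delta x.
  move=> xs; have [Mx sx _] := sP x xs; apply: klinear_scale => // z zc.
  have zk : (size (word z) <= k)%N.
    apply: leq_trans (leq_bigmax_seq x xs isT).
    exact: (leq_bigmax_seq z zc isT).
  by rewrite -(wordgK z); apply: equivariant_word ball Mx sx _ zk.
have : \sum_(x <- s) (c x : R) *: delta x = 0.
  rewrite -(eq_big_seq _ dc) -(big_morph delta (klinearD dlin) (klinear0 dlin)).
  exact: etrans (congr1 delta s0) (klinear0 dlin).
rewrite (bigD1_seq x0) //=; have [_ _ ->] := sP x0 x0s.
rewrite big1_seq; first by rewrite eqxx addr0 => <-; rewrite [RHS]mulr1.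
move=> x /andP[xx0 xs]; have [_ _ ->] := sP x xs.
by rewrite (negbTE xx0) scaler0.
Qed.

End Independence.

(** * Generation *)

Section Spanning.
Variables (K : fieldType) (B : finType) (m : nat).
Local Notation R := (galgc K B).
Local Notation V := (fmod K B m).
Local Notation vertex := (vertex B m).
Implicit Types (u v x : vertex) (vs : seq vertex) (l : letter B) (f g h : V).

(** By induction on the exploration: the last vertex v of f is cancelled by
    a multiple of some q in M and P. At a coincidence q is F v; at a forced step
    q is the translate of an h that lives on earlier vertices, so P h holds by
    induction. There is no other case, as f itself shows that v is not free. *)
Lemma coincidences_generate (M P : set (free_module K B m)) vs
    (F : vertex -> V) :
  is_submodule M -> is_submodule P -> explored vs ->
  (forall v, v \in coincidences M vs ->
     [/\ M (F v), P (F v), v \in supp (F v)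
       & supported (mem (upto vs v)) (F v)]) ->
  forall f, M f -> supported (mem vs) f -> P f.
Proof.
move=> [M0 MD MZ] [P0 PD PZ]; elim/last_ind: vs => [_ _ f _ sf|vs v IHvs ev FP].
  suff -> : f = 0 by [].
  apply/rowP => i; rewrite mxE; apply/malgP => z; rewrite mcoeff0.
  by apply/eqP; rewrite -[_ == _]negbK; apply/negP => /(sf (i, z)).
have [evs vvs _] := (explored_rcons vs v).1 ev.
have {}IHvs : forall f, M f -> supported (mem vs) f -> P f.
  apply: IHvs => // w; rewrite mem_filter => /andP[/asboolP cw wvs].
  rewrite -(upto_cat [:: v] wvs) cats1; apply: FP.
  rewrite mem_filter mem_rcons inE wvs orbT andbT; apply/asboolP.
  by rewrite -cats1; apply/coincidence_cat.
have drop_last f : supported (mem (rcons vs v)) f -> coef f v = 0 ->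
    supported (mem vs) f.
  move=> sf fv x xf; have := sf x xf.
  rewrite inE mem_rcons inE => /predU1P[xv|//].
  by rewrite xv in_supp fv eqxx in xf.
move=> f Mf sf; have [fv|fv] := eqVneq (coef f v) 0; first by apply: IHvs; auto.
suff [q [Mq Pq qv sq]] : exists q, [/\ M q, P q, coef q v != 0
    & supported (mem (rcons vs v)) q].
  pose k := coef f v / coef q v.
  rewrite -(subr_scalK k f q); apply: PD; last exact: PZ.
  apply: IHvs; first by apply: MD => //; exact: MZ.
  apply: drop_last; first exact: supported_lin.
  by rewrite coef_add coef_scal mulNr divfK ?subrr.
have [|nforced] := EM (forced M (rcons vs v) v); last first.
  have [|MF PF vF sF] := FP v.
    rewrite mem_filter mem_rcons mem_head andbT; apply/asboolP; split=> //.
    by exists f; rewrite ?upto_last.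
  by exists (F v); split=> //; rewrite upto_last in sF.
case=> u [l [+ vE [h []]]]; rewrite before_last // /Dset upto_last //.
move=> uvs Mh sh uh; exists (letterm K l *: h).
have Ph : P h.
  apply: IHvs => //; apply: drop_last; last first.
    by have := coef_leaf ev uvs vE sh.
  by move=> x /sh /andP[].
split; [exact: MZ | exact: PZ | by rewrite vE coef_letter |].
by move=> x /(supported_letter sh) /andP[].
Qed.

End Spanning.

(** * Bases of finitely generated modules *)

Section Rank.
Variables (A : nzRingType) (V : lmodType A^c).
Implicit Types (M P S : set V) (s t : seq V).

(** Linear combinations of one fixed list: unlike the span of a set, it is
    visibly closed under addition, and it agrees with it for uniq lists. *)
Definition seq_span s : set V :=
  [set v | exists c : V -> A^c, v = \sum_(x <- s) c x *: x].

Lemma seq_span_submodule s : is_submodule (seq_span s).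
Proof.
split; first by exists (fun=> 0); rewrite big1 // => x _; rewrite scale0r.
  move=> _ _ [c ->] [d ->]; exists (fun x => c x + d x).
  by rewrite -big_split; apply: eq_bigr => x _; rewrite scalerDl.
move=> a _ [c ->]; exists (fun x => a * c x).
by rewrite scaler_sumr; apply: eq_bigr => x _; rewrite scalerA.
Qed.

Lemma mem_seq_span s x : uniq s -> x \in s -> seq_span s x.
Proof.
move=> us xs; exists (fun y => (y == x)%:R).
rewrite (bigD1_seq x) //= eqxx scale1r.
by rewrite big1 ?addr0 // => y /negbTE ->; rewrite scale0r.
Qed.

Lemma mspan_min P S : is_submodule P -> S `<=` P -> mspan S `<=` P.
Proof.
move=> [P0 PD PZ] SP _ [s [c [sS ->]]].
rewrite big_seq; apply: (big_ind P) => // x xs.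
by apply: PZ; apply: SP; exact: sS.
Qed.

Lemma sub_mspan S : S `<=` mspan S.
Proof.
move=> x Sx; exists [:: x], (fun=> 1); split; last by rewrite big_seq1 scale1r.
by move=> y; rewrite inE => /eqP ->.
Qed.

Lemma mspan_seq s : uniq s -> mspan [set` s] = seq_span s.
Proof.
move=> us; apply/seteqP; split=> [|v [c vE]].
  apply: mspan_min (seq_span_submodule s) _ => x; exact: mem_seq_span.
by exists s, c.
Qed.

(** The finitely many generators in s involve finitely many elements t of the
    basis S; these already generate M, so by independence S has no others. *)
Lemma basis_finite M s S : uniq s -> mspan [set` s] = M -> is_basis M S ->
  exists2 t, uniq t & S = [set` t].
Proof.
move=> us sM [SM Si].
have /choice[t_ t_P] : forall x : V, exists t, x \in s ->
    (forall y, y \in t -> S y) /\ seq_span (undup t) x.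
  move=> x; have [xs|] := boolP (x \in s); last by exists [::].
  have [t [c [tS xE]]] : mspan S x by rewrite SM -sM; exact: sub_mspan.
  exists t => _; split=> //.
  have tsub : mspan [set` undup t] `<=` seq_span (undup t).
    by rewrite mspan_seq ?undup_uniq.
  by apply: tsub; exists t, c; split=> // y; rewrite /= mem_undup.
pose t := undup (flatten [seq t_ x | x <- s]).
have ut : uniq t := undup_uniq _.
have tS y : y \in t -> S y.
  by rewrite mem_undup => /flatten_mapP[x xs] /((t_P x xs).1).
have Mt : M `<=` seq_span t.
  rewrite -sM; apply: mspan_min (seq_span_submodule t) _ => x /= xs.
  have [_] := t_P x xs; rewrite -mspan_seq ?undup_uniq //.
  apply: (mspan_min (seq_span_submodule t)) => y /= yt.
  apply: mem_seq_span => //.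
  by rewrite mem_undup; apply/flatten_mapP; exists x; rewrite // -mem_undup.
exists t => //; apply/seteqP; split=> [y Sy /=|y /tS //].
apply/negPn/negP => yt.
have [c yE] : seq_span t y by apply: Mt; rewrite -SM; exact: sub_mspan.
have := Si (y :: t) (fun x => if x == y then -1 else c x).
rewrite /= yt => /(_ ut) indep.
have : (if y == y then -1 else c y) = 0 :> A^c.
  apply: indep (mem_head _ _).
    by move=> x; rewrite inE => /predU1P[->|/tS].
  rewrite big_cons eqxx scaleN1r {1}yE addrC.
  apply/eqP; rewrite subr_eq0; apply/eqP.
  by apply: eq_big_seq => x xt; case: eqP => // xy; rewrite -xy xt in yt.
by rewrite eqxx => /eqP; rewrite oppr_eq0 oner_eq0.
Qed.

Variables (k : fieldType) (eps : {rmorphism A^c -> k}).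

(** Writing s in terms of t and back gives matrices P and Q over the ring with
    P Q = 1 by independence of s; over a field, which is reached through eps,
    this bounds the size of P. *)
Lemma indep_size_le s t : uniq s -> lin_indep [set` s] ->
  (forall x, x \in s -> seq_span t x) -> (forall y, y \in t -> seq_span s y) ->
  (size s <= size t)%N.
Proof.
move=> us si st ts.
have /choice[p pE] x : exists c : V -> A^c,
    x \in s -> x = \sum_(y <- t) c y *: y.
  have [/st[c xE]|_] := boolP (x \in s); first by exists c.
  by exists (fun=> 0).
have /choice[q qE] y : exists c : V -> A^c,
    y \in t -> y = \sum_(x <- s) c x *: x.
  have [/ts[c yE]|_] := boolP (y \in t); first by exists c.
  by exists (fun=> 0).
have pq x z : x \in s -> z \in s -> \sum_(y <- t) p x y * q y z = (x == z)%:R.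
  move=> xs zs; apply/eqP; rewrite -subr_eq0; apply/eqP; move: z zs.
  apply: (si s) => //.
  under eq_bigr do rewrite scalerBl; rewrite sumrB.
  apply/eqP; rewrite subr_eq0; apply/eqP; transitivity x.
    rewrite [RHS]pE //; under [LHS]eq_bigr do rewrite scaler_suml.
    rewrite exchange_big /=; apply: eq_big_seq => y yt.
    rewrite [X in _ = _ *: X](qE y yt) scaler_sumr.
    by apply: eq_bigr => z _; rewrite scalerA.
  rewrite (bigD1_seq x) //= eqxx scale1r big1 ?addr0 // => z.
  by rewrite eq_sym => /negbTE ->; rewrite scale0r.
pose P := \matrix_(i < size s, j < size t) eps (p s`_i t`_j).
pose Q := \matrix_(j < size t, i < size s) eps (q t`_j s`_i).
apply: (@mulmx1_min _ _ _ P Q); apply/matrixP => i j; rewrite !mxE.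
under eq_bigr do rewrite !mxE -rmorphM.
rewrite -rmorph_sum /= -(big_mkord xpredT (fun l => p s`_i t`_l * q t`_l s`_j)).
rewrite -(big_nth 0 xpredT (fun y => p s`_i y * q y s`_j)) pq ?mem_nth //.
by rewrite nth_uniq // rmorph_nat.
Qed.

Lemma has_rank_seq M s : uniq s -> is_basis M [set` s] -> has_rank M (size s).
Proof.
move=> us bs; split=> [|S bS]; first by exists [set` s].
have [t ut St] := basis_finite us bs.1 bS; subst S.
have le s1 s2 : uniq s1 -> uniq s2 -> is_basis M [set` s1] ->
    is_basis M [set` s2] -> (size s1 <= size s2)%N.
  move=> u1 u2 [M1 i1] [M2 _]; apply: indep_size_le => // x xs.
    by rewrite -mspan_seq // M2 -M1; exact: sub_mspan.
  by rewrite -mspan_seq // M1 -M2; exact: sub_mspan.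
have -> : size s = size t by apply/eqP; rewrite eqn_leq !le.
have -> : [set` t] = [set` [fset x in t]%fset].
  by apply/seteqP; split=> x /=; rewrite inE.
by apply/card_eq_fsetP; rewrite card_fseq undup_id.
Qed.

End Rank.

(** * The augmentation of the group algebra *)

Section Augmentation.
Variables (K : fieldType) (B : finType).
Local Notation A := (group_alg K (free_group B)).
Local Notation R := (galgc K B).

Definition aug (a : R) : K := mmap idfun (fun=> 1) (a : A).

Lemma aug_is_additive : additive aug.
Proof.
move=> a b.
exact: (@mmap_is_additive _ _ _ (idfun : {additive K -> K}) (fun=> 1)
          (a : A) (b : A)).
Qed.

HB.instance Definition _ := GRing.isAdditive.Build R K aug aug_is_additive.

Lemma aug_monom c z : aug (monom c z) = c.
Proof. by rewrite /aug monomU mmapU mulr1. Qed.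

Lemma aug_is_multiplicative : multiplicative aug.
Proof.
split=> [a b|]; last by rewrite -(scal1 K B) aug_monom.
rewrite [a]monomE [b]monomE mulr_suml !raddf_sum mulr_suml.
apply: eq_bigr => y _; rewrite mulr_sumr !raddf_sum mulr_sumr.
by apply: eq_bigr => z _; rewrite /= monomM !aug_monom.
Qed.

HB.instance Definition _ :=
  GRing.isMultiplicative.Build R K aug aug_is_multiplicative.

End Augmentation.

(** * Existence of explorations *)

Section Existence.
Variables (B : finType) (m : nat) (T : 'I_m -> {fset free_group B}).
Hypothesis hT : forall i, is_subtree (T i).
Local Notation vertex := (vertex B m).
Implicit Types (u v x : vertex) (vs : seq vertex).

Lemma first_unexposed vs i (x : free_group B) (p : seq (free_group B)) :
  (i, x) \in vs -> path (@cayley_adj B) x p -> {subset p <= T i} ->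
  (i, last x p) \notin vs ->
  exists u v, [/\ u \in vs, v \notin vs, v \in in_forest T & adj u v].
Proof.
elim: p x => [|y p IHp] x /= xvs; first by rewrite xvs.
case/andP=> xy yp pT lastp; have [yvs|yvs] := boolP ((i, y) \in vs).
  by apply: (IHp y) => // z zp; apply: pT; rewrite inE zp orbT.
exists (i, x), (i, y); split=> //; first exact: pT (mem_head _ _).
by case/existsP: xy => l /eqP ->; apply/adjP; exists l.
Qed.

(** If the tree of the unexposed w has an exposed vertex, the path from it to w
    inside the tree leaves the exposed part somewhere; otherwise w can be the
    first vertex of its tree. *)
Lemma explored_grow vs w : explored vs -> w \notin vs -> w \in in_forest T ->
  {subset vs <= in_forest T} ->
  exists v, [/\ explored (rcons vs v), v \notin vs & v \in in_forest T].
Proof.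
move=> evs wvs wT vsT.
have [[u [uvs uw]]|none] := EM (exists u, u \in vs /\ u.1 = w.1); last first.
  exists w; split=> //; apply/explored_rcons; split=> //; right=> u uvs.
  by apply/eqP => uw; apply: none; exists u.
have wT' : w.2 \in T u.1 by rewrite uw.
have [p [[up lastp _ pT] _]] := hT (vsT u uvs) wT'.
have uvs' : (u.1, u.2) \in vs by rewrite -surjective_pairing.
have lvs : (u.1, last u.2 p) \notin vs.
  by rewrite lastp uw -surjective_pairing.
have [u' [v [u'vs vvs vT u'v]]] := first_unexposed uvs' up pT lvs.
by exists v; split=> //; apply/explored_rcons; split=> //; left; exists u'.
Qed.

Lemma exploration_exists : exists vs, exploration T vs.
Proof.
pose all_vs : seq vertex := [seq (i, z) | i <- enum 'I_m, z <- enum_fset (T i)].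
have allP v : v \in in_forest T -> v \in all_vs.
  move=> vT; apply/allpairsPdep; exists v.1, v.2.
  by rewrite mem_enum -surjective_pairing.
suff grow n : exists vs, [/\ explored vs, {subset vs <= in_forest T}
    & (n <= size vs)%N \/ {subset in_forest T <= vs}].
  have [vs [[uvs evs] vsT [nvs|Tvs]]] := grow (size all_vs).+1.
    have := uniq_leq_size uvs (fun v vvs => allP v (vsT v vvs)).
    by rewrite leqNgt nvs.
  exists vs; split=> // v; apply/idP/idP; [exact: vsT | exact: Tvs].
elim: n => [|n [vs [evs vsT [nvs|Tvs]]]].
- by exists [::]; split=> //; left.
- have [Tvs|nT] := EM {subset in_forest T <= vs}.
    by exists vs; split=> //; right.
  have [w [wT wvs]] : exists w, w \in in_forest T /\ w \notin vs.
    apply: contrapT => none; apply: nT => w wT.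
    by apply/negPn/negP => wvs; apply: none; exists w.
  have [v [ev vvs vT]] := explored_grow evs wvs wT vsT.
  exists (rcons vs v); split=> //; last by left; rewrite size_rcons.
  by move=> x; rewrite mem_rcons inE => /predU1P[->|/vsT].
- by exists vs; split=> //; right.
Qed.

End Existence.

(** * Bases led by coincidences *)

Section Basis.
Variables (K : fieldType) (B : finType) (m : nat).
Local Notation V := (fmod K B m).
Local Notation vertex := (vertex B m).
Variables (T : 'I_m -> {fset free_group B}) (M : set (free_module K B m)).
Hypothesis subM : is_submodule M.
Hypothesis genM : exists2 S : set (free_module K B m),
  mspan S = M & forall f, S f -> supported (in_forest T) f.

Lemma supported_upto vs (f : V) v :
  supported (mem vs) f -> is_leading vs f v -> supported (mem (upto vs v)) f.
Proof.
move=> sf [_ lf] x xf; have xvs : x \in vs := sf x xf.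
by rewrite inE /upto in_take // ltnS lf.
Qed.

(** The leading vertices being distinct, f is injective, so the number of
    coincidences is also the size of the basis that f enumerates. *)
Lemma leading_basis vs (f : 'I_(size (coincidences M vs)) -> V) :
  exploration T vs ->
  (forall i, [/\ M (f i), supported (in_forest T) (f i)
     & is_leading vs (f i) (tnth (in_tuple (coincidences M vs)) i)]) ->
  is_basis M (range f) /\ has_rank M (size (coincidences M vs)).
Proof.
move=> [uvs vsT vsP] fP; have evs : explored vs := conj uvs vsP.
set co := coincidences M vs in f fP *.
have uco : uniq co := filter_uniq _ uvs.
(* f is indexed by ranks among the coincidences, F by the vertices. *)
pose F v : V := if insub (index v co) is Some i then f i else 0.
have FE i : F (tnth (in_tuple co) i) = f i.
  have -> : F (tnth (in_tuple co) i) =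
      if insub (i : nat) is Some i then f i else 0.
    by rewrite /F (tnth_nth (tnth (in_tuple co) i)) index_uniq.
  by rewrite valK.
have fF : range f = [set F v | v in [set` co]].
  apply/seteqP; split=> [_ [i _ <-]|_ [v vco <-]].
    by exists (tnth (in_tuple co) i); [exact: mem_tnth | exact: FE].
  by have /tnthP[i ->] : v \in in_tuple co := vco; exists i; rewrite ?FE.
have FP v : v \in co -> [/\ M (F v), v \in supp (F v)
    & supported (mem (upto vs v)) (F v)].
  move=> vco; have /tnthP[i ->] : v \in in_tuple co := vco.
  rewrite FE; have [Mf sf lf] := fP i; split=> //; first by case: lf.
  by apply: supported_upto => // x /sf; rewrite -vsT.
have finj : injective f.
  move=> i j fij; have [_ _ [li lei]] := fP i; have [_ _ [lj lej]] := fP j.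
  have mem_co k : tnth (in_tuple co) k \in vs.
    by have := mem_tnth k (in_tuple co); rewrite mem_filter => /andP[].
  have e : index (tnth (in_tuple co) i) vs = index (tnth (in_tuple co) j) vs.
    by apply/eqP; rewrite eqn_leq lej ?lei // ?fij // -fij.
  apply: (elimT (tuple_uniqP (in_tuple co)) uco).
  by rewrite -(nth_index (tnth (in_tuple co) i) (mem_co i)) e nth_index.
pose fs := [seq f i | i <- enum 'I_(size co)].
have ufs : uniq fs by rewrite map_inj_uniq ?enum_uniq.
have fsE : range f = [set` fs].
  apply/seteqP; split=> [_ [i _ <-]|_ /= /mapP[i _ ->]]; last by exists i.
  by apply: map_f; rewrite mem_enum.
have basis : is_basis M (range f).
  split; last by rewrite fF; exact: coincidences_indep.
  apply/seteqP; split; first by apply: mspan_min => // _ [i _ <-]; case: (fP i).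
  rewrite fsE mspan_seq //; case: genM => S SM ST; rewrite -{1}SM.
  apply: mspan_min (seq_span_submodule fs) _ => g Sg.
  have subP := seq_span_submodule fs.
  apply: (coincidences_generate subM subP evs (F := F)) => //.
  - move=> v vco; have [? ? ?] := FP v vco; split=> //.
    have /tnthP[i ->] : v \in in_tuple co := vco; rewrite FE.
    by apply: mem_seq_span => //; apply: map_f; rewrite mem_enum.
  - by rewrite -SM; exact: sub_mspan.
  - by move=> x /(ST _ Sg); rewrite -vsT.
split=> //.
have -> : size co = size fs by rewrite size_map size_enum_ord.
pose eps : {rmorphism (group_alg K (free_group B))^c -> K} := aug (B := B).
by apply: (has_rank_seq eps) => //; rewrite -fsE.
Qed.

Lemma leading_family_exists vs : exploration T vs ->
  exists f : 'I_(size (coincidences M vs)) -> V,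
    forall i, [/\ M (f i), supported (in_forest T) (f i)
     & is_leading vs (f i) (tnth (in_tuple (coincidences M vs)) i)].
Proof.
move=> [uvs vsT _].
suff /choice[f fP] : forall i : 'I_(size (coincidences M vs)), exists f : V,
    [/\ M f, supported (in_forest T) f
     & is_leading vs f (tnth (in_tuple (coincidences M vs)) i)] by exists f.
move=> i; have := mem_tnth i (in_tuple (coincidences M vs)).
rewrite mem_filter => /andP[/asboolP [_ [f [Mf sf] vf]] vvs].
exists f; split=> //; first by move=> x /sf /mem_take; rewrite vsT.
split=> // w /sf; rewrite inE /upto => wup.
by have := index_ltn wup; rewrite ltnS.
Qed.

End Basis.

Theorem theorem3p8 (K : finFieldType) (B : finType) (m : nat) (hm : (0 < m)%N)
    (T : 'I_m -> {fset free_group B}) (hT : forall i : 'I_m, is_subtree (T i))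
    (M : set (free_module K B m)) (hM : is_submodule M)
    (hgen : exists2 S : set (free_module K B m),
        mspan S = M & forall f, S f -> supported (in_forest T) f) :
  [/\ forall vs : seq (vertex B m), exploration T vs ->
        has_rank M (size (coincidences M vs)),
      exists2 S : set (free_module K B m),
        is_basis M S & forall f, S f -> supported (in_forest T) f
    & forall vs : seq (vertex B m), exploration T vs ->
        forall f : 'I_(size (coincidences M vs)) -> free_module K B m,
          (forall i, [/\ M (f i), supported (in_forest T) (f i)
             & is_leading vs (f i) (tnth (in_tuple (coincidences M vs)) i)]) ->
          is_basis M (range f)].
Proof.
have basis vs (ev : exploration T vs) f fP :=
  @leading_basis K B m T M hM hgen vs f ev fP.
split.
- move=> vs ev; have [f fP] := leading_family_exists M ev.
  by case: (basis vs ev f fP).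
- have [vs ev] := exploration_exists hT.
  have [f fP] := leading_family_exists M ev.
  exists (range f); first by case: (basis vs ev f fP).
  by move=> _ [i _ <-]; case: (fP i).
- by move=> vs ev f fP; case: (basis vs ev f fP).
Qed.
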